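(* Let $k$ be a field of characteristic zero and let $k[[x]]=k[[x_1,\dots,x_n]]$ be the formal power series algebra over $k$ in $n$ commutative variables. Then the LFED Conjecture holds for $k[[x]]$; that is: for every locally finite $k$-derivation $D$ of $k[[x]]$, the image $\operatorname{Im} D$ is a Mathieu-Zhao space of $k[[x]]$, and for every locally finite $k\mathcal{E}$-derivation $\delta$ of $k[[x]]$, the image $\operatorname{Im}\delta$ is a Mathieu-Zhao space of $k[[x]]$.
   Context: Let $\mathcal{A}$ be a commutative $k$-algebra. A $k$-derivation of $\mathcal{A}$ is a $k$-linear map $D:\mathcal{A}\to\mathcal{A}$ with $D(ab)=D(a)b+aD(b)$ for all $a,b\in\mathcal{A}$ (no continuity is assumed). A $k\mathcal{E}$-derivation of $\mathcal{A}$ is a map of the form $\delta=1-\phi$, where $1$ is the identity map of $\mathcal{A}$ and $\phi$ is a $k$-algebra endomorphism of $\mathcal{A}$. A $k$-linear map $T:\mathcal{A}\to\mathcal{A}$ is locally finite if for each $a\in\mathcal{A}$ the $k$-subspace spanned by the elements $T^m(a)$ ($m\ge 0$) is finite dimensional over $k$. For a $k$-subspace $M$ of $\mathcal{A}$, the radical $\mathfrak{r}(M)$ is the set of $a\in\mathcal{A}$ such that $a^m\in M$ for all sufficiently large $m$. The subspace $M$ is a Mathieu-Zhao space (MZ-space) of $\mathcal{A}$ if for every $a\in\mathfrak{r}(M)$ and every $b\in\mathcal{A}$ there exists $N_b\ge 1$ such that $ba^m\in M$ for all $m\ge N_b$. *)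

(* Defs.v *)
From HB Require Import structures.
From mathcomp Require Import all_boot all_algebra.
From mathcomp Require Import boolp classical_sets mpoly.

Set Implicit Arguments.
Unset Strict Implicit.
Unset Printing Implicit Defensive.

Import GRing.Theory.

Local Open Scope ring_scope.

(* [mfps n R] is R[[x_1, ..., x_n]]: a series is its family of coefficients,
   indexed by the exponent vectors 'X_{1..n}. *)
Record mfps (n : nat) (R : Type) := MFps { fcoeff : 'X_{1..n} -> R }.

Section MfpsChoice.
Variables (n : nat) (R : Type).

Lemma mfpsP (f g : mfps n R) : fcoeff f =1 fcoeff g -> f = g.
Proof. by case: f g => [f] [g] /= /funext ->. Qed.

HB.instance Definition _ := gen_eqMixin (mfps n R).
HB.instance Definition _ := gen_choiceMixin (mfps n R).
End MfpsChoice.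

Section MfpsAlgebra.
Variables (n : nat) (R : comNzRingType).
Implicit Types (f g h : mfps n R) (m : 'X_{1..n}).

Definition fps_zero : mfps n R := MFps (fun=> 0).
Definition fps_opp f : mfps n R := MFps (fun m => - fcoeff f m).
Definition fps_add f g : mfps n R := MFps (fun m => fcoeff f m + fcoeff g m).
Definition fps_one : mfps n R := MFps (fun m => (m == 0%MM)%:R).
Definition fps_scale (c : R) f : mfps n R := MFps (fun m => c * fcoeff f m).

(* Cauchy product; the degree bound only makes the index type finite, it is
   implied by m = k.1 + k.2. *)
Definition fps_mul f g : mfps n R := MFps (fun m =>
  \sum_(k : 'X_{1..n < (mdeg m).+1, (mdeg m).+1} | m == (k.1 + k.2)%MM)
    fcoeff f k.1 * fcoeff g k.2).

Lemma fps_addA : associative fps_add.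
Proof. by move=> f g h; apply: mfpsP => m /=; rewrite addrA. Qed.
Lemma fps_addC : commutative fps_add.
Proof. by move=> f g; apply: mfpsP => m /=; rewrite addrC. Qed.
Lemma fps_add0 : left_id fps_zero fps_add.
Proof. by move=> f; apply: mfpsP => m /=; rewrite add0r. Qed.
Lemma fps_addN : left_inverse fps_zero fps_opp fps_add.
Proof. by move=> f; apply: mfpsP => m /=; rewrite addNr. Qed.

HB.instance Definition _ :=
  GRing.isZmodule.Build (mfps n R) fps_addA fps_addC fps_add0 fps_addN.

(* The ring axioms are transported from {mpoly R[n]} through the truncations
   [fps_trunc d f], which agree with [f] in degrees < d. *)
Definition fps_trunc d f : {mpoly R[n]} :=
  \sum_(m : 'X_{1..n < d}) (fcoeff f m *: 'X_[m]).

Lemma fps_truncE d f m : (mdeg m < d)%N -> (fps_trunc d f)@_m = fcoeff f m.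
Proof. by move=> lt_md; rewrite mcoeff_mpoly. Qed.

Lemma fps_mul_mpoly d f g (p q : {mpoly R[n]}) m :
    (mdeg m < d)%N ->
    (forall m', (mdeg m' < d)%N -> p@_m' = fcoeff f m') ->
    (forall m', (mdeg m' < d)%N -> q@_m' = fcoeff g m') ->
  (p * q)@_m = fcoeff (fps_mul f g) m.
Proof.
move=> lt_md pf qg; rewrite mcoeffM /=; apply: eq_bigr => -[[k lt_k] [l lt_l]] _.
by rewrite pf ?qg //=; [apply: leq_trans lt_l _ | apply: leq_trans lt_k _].
Qed.

Lemma fps_mulA : associative fps_mul.
Proof.
move=> f g h; apply: mfpsP => m; set d := (mdeg m).+1.
have fgh u v m' : (mdeg m' < d)%N ->
    (fps_trunc d u * fps_trunc d v)@_m' = fcoeff (fps_mul u v) m'.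
  by move=> lt_m'd; apply: (@fps_mul_mpoly d) => // *; rewrite fps_truncE.
have tr u m' : (mdeg m' < d)%N -> (fps_trunc d u)@_m' = fcoeff u m'.
  exact: fps_truncE.
rewrite -(fps_mul_mpoly (ltnSn _) (tr f) (fgh g h)).
by rewrite -(fps_mul_mpoly (ltnSn _) (fgh f g) (tr h)) mulrA.
Qed.

Lemma fps_mulC : commutative fps_mul.
Proof.
move=> f g; apply: mfpsP => m; have tr u := @fps_truncE (mdeg m).+1 u.
by rewrite -!(fps_mul_mpoly (ltnSn _) (tr _) (tr _)) mulrC.
Qed.

Lemma fps_mul1 : left_id fps_one fps_mul.
Proof.
move=> f; apply: mfpsP => m; have tr u := @fps_truncE (mdeg m).+1 u.
have one1 m' : (mdeg m' < (mdeg m).+1)%N -> 1@_m' = fcoeff fps_one m'.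
  by move=> _; rewrite mcoeff1.
by rewrite -(fps_mul_mpoly (ltnSn _) one1 (tr f)) mul1r fps_truncE.
Qed.

Lemma fps_mulDl : left_distributive fps_mul fps_add.
Proof.
move=> f g h; apply: mfpsP => m /=; rewrite -big_split /=.
by apply: eq_bigr => k _; rewrite mulrDl.
Qed.

Lemma fps_one_neq0 : fps_one != 0.
Proof.
apply/eqP => /(congr1 (fun f => fcoeff f 0%MM)) /= /eqP.
by rewrite eqxx oner_eq0.
Qed.

HB.instance Definition _ := GRing.Zmodule_isComNzRing.Build (mfps n R)
  fps_mulA fps_mulC fps_mul1 fps_mulDl fps_one_neq0.

Lemma fps_scaleA a b f : fps_scale a (fps_scale b f) = fps_scale (a * b) f.
Proof. by apply: mfpsP => m /=; rewrite mulrA. Qed.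
Lemma fps_scale1 : left_id 1 fps_scale.
Proof. by move=> f; apply: mfpsP => m /=; rewrite mul1r. Qed.
Lemma fps_scaleDr : right_distributive fps_scale +%R.
Proof. by move=> a f g; apply: mfpsP => m /=; rewrite mulrDr. Qed.
Lemma fps_scaleDl f : {morph fps_scale^~ f : a b / a + b}.
Proof. by move=> a b; apply: mfpsP => m /=; rewrite mulrDl. Qed.

HB.instance Definition _ := GRing.Zmodule_isLmodule.Build R (mfps n R)
  fps_scaleA fps_scale1 fps_scaleDr fps_scaleDl.

Lemma fps_scaleAl (a : R) (f g : mfps n R) : a *: (f * g) = (a *: f) * g.
Proof.
apply: mfpsP => m /=; rewrite mulr_sumr.
by apply: eq_bigr => k _; rewrite mulrA.
Qed.

HB.instance Definition _ :=
  GRing.Lmodule_isLalgebra.Build R (mfps n R) fps_scaleAl.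
HB.instance Definition _ := GRing.Lalgebra_isComAlgebra.Build R (mfps n R).

End MfpsAlgebra.

Section LFED.
Variables (k : fieldType) (A : comAlgType k).
Implicit Types (M : set A) (T D delta : A -> A).

Definition subspace M := M 0 /\ forall (c : k) u v, M u -> M v -> M (c *: u + v).

Definition span_set M : set A :=
  [set v | exists (r : nat) (c : 'I_r -> k) (e : 'I_r -> A),
     (forall i, M (e i)) /\ v = \sum_(i < r) c i *: e i].

Definition finite_dim M :=
  exists (r : nat) (e : 'I_r -> A), M = span_set (range e).

Definition derivation D :=
  linear D /\ forall a b, D (a * b) = D a * b + a * D b.

(* Algebra endomorphisms are unital. *)
Definition E_derivation delta :=
  exists phi : {lrmorphism A -> A}, forall a, delta a = a - phi a.

Definition locally_finite T :=
  linear T /\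
  forall a, finite_dim (span_set (range (fun m : nat => iter m T a))).

Definition radical M : set A :=
  [set a | exists N : nat, forall m : nat, (N <= m)%N -> M (a ^+ m)].

Definition MZ_space M :=
  subspace M /\
  forall a, radical M a -> forall b : A,
    exists N : nat, (1 <= N)%N /\ forall m : nat, (N <= m)%N -> M (b * a ^+ m).

End LFED.

(* Main.v *)
Require Import Defs.
From HB Require Import structures.
From mathcomp Require Import all_boot all_order all_algebra.
From mathcomp Require Import boolp classical_sets mpoly.
From mathcomp Require Import ring.

(** Local finiteness is so strong on a complete ring that it leaves almost
    nothing: a locally finite derivation of [k[[x]]] is zero, and a locally
    finite algebra endomorphism [phi] satisfies [phi^s = phi^(s + r)] for some
    [s] and some [r > 0].

    From local to uniform. Let [T] be a linear operator which is continuous for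
    the [x]-adic filtration [F_0, F_1, ...] and such that each series [f] is
    killed by some nonzero polynomial in [T].  If no single nonzero polynomial in
    [T] killed some [F_M], then one could build, as in the Baire category
    theorem, a convergent sequence of series whose limit [f] has all of
    [f, T f, T^2 f, ...] linearly independent: at each step a correction of high
    order makes one more iterate independent modulo some [F_N], which later
    corrections cannot undo.  This is [locally_algebraic_uniform].

    Derivations. They are continuous because a series of order [N + 1] is a sum
    of products [x_i g_i] with [g_i] of order [N]. So [p(D)] vanishes on some
    [F_M], with [p] of degree [e] and nonzero leading coefficient [a].
    Commuting [p(D)] successively [e] times with multiplication by [c] leaves the
    multiplication by [e! a D(c)^e], which therefore kills [F_M]; as [k[[x]]] is
    a domain of characteristic zero, [D c = 0]
    ([algebraic_derivation_eq0]).  The image of [D] is then [0], a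
    Mathieu-Zhao space of any domain.

    Endomorphisms. They are local, hence continuous, and a nonzero polynomial in
    [phi] vanishes on some [F_M].  Were the powers of [phi] pairwise distinct,
    Dedekind's independence of characters would make some power vanish on [F_1],
    and then this power and the next one would both be the evaluation at the
    origin. Hence [phi^s = phi^(s + r)] ([locally_finite_endo_periodic]).  If
    now [a^m] lies in the image of [1 - phi] for all large [m], applying
    [phi^s + ... + phi^(s + r - 1)] shows that the [m]-th power sum of the
    elements [phi^(s + i) a], [i < r], vanishes for all large [m]; so these
    elements vanish.  Then [phi^s] kills [b a^m] for [m > 0], and [1 - phi] is
    invertible on the kernel of [phi^s], so that [b a^m] lies in the image
    ([eventually_periodic_MZ]). *)

Set Implicit Arguments.
Unset Strict Implicit.
Unset Printing Implicit Defensive.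

Import Order.TTheory GRing.Theory.

Local Open Scope ring_scope.

(** * Polynomials in a linear operator *)

Section OperatorPolynomials.
Variables (k : fieldType) (V : lmodType k).
Implicit Types (T : V -> V) (p q : {poly k}) (v w : V).

(** [p(T) v].  The arguments come in this order so that [opoly T v] is the
    linear map sending [p] to [p(T) v]. *)
Definition opoly T v p : V := \sum_(i < size p) p`_i *: iter i T v.

Lemma opolyE T d p v :
  (size p <= d)%N -> opoly T v p = \sum_(i < d) p`_i *: iter i T v.
Proof.
move=> lepd; rewrite /opoly (big_ord_widen _ (fun i => p`_i *: iter i T v) lepd).
rewrite big_mkcond; apply: eq_bigr => i _; case: ltnP => // ge_ip.
by rewrite nth_default ?scale0r.
Qed.

Lemma opoly_is_linear T v : linear (opoly T v).
Proof.
move=> c p q; pose d := maxn (size p) (size q).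
rewrite !(@opolyE T d) ?leq_maxl ?leq_maxr //; last first.
  by rewrite (leq_trans (size_polyD _ _)) // geq_max leq_maxr
             (leq_trans (size_scale_leq _ _)) // leq_maxl.
rewrite scaler_sumr -big_split; apply: eq_bigr => i _.
by rewrite coefD coefZ scalerDl scalerA.
Qed.

HB.instance Definition _ T v := GRing.isLinear.Build k {poly k} V *:%R
  (opoly T v) (opoly_is_linear T v).

Lemma opolyMX T p v : opoly T v (p * 'X) = opoly T (T v) p.
Proof.
rewrite (@opolyE T (size p).+1); last first.
  by rewrite (leq_trans (size_polyMleq _ _)) // size_polyX addn2.
rewrite big_ord_recl /= coefMX scale0r add0r.
by apply: eq_bigr => i _; rewrite coefMX -iterSr.
Qed.

Lemma opolyC T c v : opoly T v c%:P = c *: v.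
Proof. by rewrite (@opolyE T 1) ?size_polyC_leq1 // big_ord1 coefC. Qed.

Lemma linear_at0 T : linear T -> T 0 = 0.
Proof. by move=> linT; have := linT (-1) 0 0; rewrite scaleN1r addNr scaleN1r addNr. Qed.

Lemma iter_linear T i : linear T -> linear (iter i T).
Proof. by move=> linT; elim: i => // i IH c v w; rewrite /= IH linT. Qed.

Lemma opoly_linearl T p : linear T -> linear ((opoly T)^~ p).
Proof.
move=> linT c v w; rewrite /opoly scaler_sumr -big_split; apply: eq_bigr => i _.
by rewrite iter_linear // scalerDr !scalerA mulrC.
Qed.

Lemma opolyBl T p v w : linear T -> opoly T (v - w) p = opoly T v p - opoly T w p.
Proof. by move=> linT; rewrite addrC -scaleN1r opoly_linearl // scaleN1r addrC. Qed.

(** Both sides are [p] evaluated at the operator [1 - T]. *)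
Lemma opoly_subid T U p v : (forall w, U w = w - T w) -> linear T ->
  opoly U v p = opoly T v (p \Po (1 - 'X)).
Proof.
move=> UE linT; elim/poly_ind: p v => [|p c IH] v; first by rewrite comp_poly0 !linear0.
rewrite comp_poly_MXaddC mulrBr mulr1 !linearD linearN /= !opolyMX !opolyC IH UE.
by rewrite opolyBl.
Qed.

(** [p |-> p(1 - X)] is an involution. *)
Lemma comp_subX_eq0 p : (p \Po (1 - 'X) == 0) = (p == 0).
Proof.
apply/eqP/eqP => [p0|->]; last exact: comp_poly0.
have XX : (1 - 'X : {poly k}) \Po (1 - 'X) = 'X.
  by rewrite comp_polyB comp_polyC comp_polyX opprB addrC subrK.
by rewrite -[p]comp_polyXr -XX comp_polyA p0 comp_poly0.
Qed.

End OperatorPolynomials.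

(** If the orbit of [a] lies in a space spanned by [r] vectors, its first
    [r + 1] elements satisfy a linear relation. *)
Lemma locally_finite_annihilated (k : fieldType) (A : comAlgType k) (T : A -> A) a :
  locally_finite T -> exists2 p : {poly k}, p != 0 & opoly T a p = 0.
Proof.
move=> [_ /(_ a)[r [e spanE]]].
have inspan i : exists c : 'I_r -> k, iter i T a = \sum_(j < r) c j *: e j.
  have : span_set (range (fun m : nat => iter m T a)) (iter i T a).
    exists 1%N, (fun=> 1), (fun=> iter i T a); split; first by move=> ?; exists i.
    by rewrite big_ord1 scale1r.
  rewrite spanE => -[s [c [f [rangef ->]]]].
  elim/big_ind: _ => [|u v [cu ->] [cv ->]|j _].
  - by exists (fun=> 0); rewrite big1 // => j _; rewrite scale0r.
  - exists (fun j => cu j + cv j); rewrite -big_split.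
    by apply: eq_bigr => j _; rewrite scalerDl.
  - have [l _ <-] := rangef j; exists (fun l' => (l' == l)%:R * c j).
    rewrite (bigD1 l) //= eqxx mul1r big1 ?addr0 // => l' /negPf->.
    by rewrite mul0r scale0r.
have [c cE] := choice inspan.
pose C := \matrix_(i < r.+1, j < r) c i j.
have : kermx C != 0.
  by rewrite -mxrank_eq0 mxrank_ker -lt0n subn_gt0 ltnS rank_leq_col.
case/rowV0Pn => v /sub_kermxP vC v0; exists (rVpoly v).
  by apply: contraNneq v0 => rv0; rewrite -[v]rVpolyK rv0 linear0.
rewrite (@opolyE _ _ _ r.+1) ?size_poly //.
under eq_bigr => i _ do rewrite coef_rVpoly_ord cE scaler_sumr.
rewrite exchange_big big1 // => j _ /=.
under eq_bigr => i _ do rewrite scalerA.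
have vCj : (v *m C) 0 j = 0 by rewrite vC mxE.
rewrite -scaler_suml; suff -> : \sum_(i < r.+1) v 0 i * c i j = 0 by rewrite scale0r.
by move: vCj; rewrite mxE; under eq_bigr do rewrite mxE.
Qed.

(** * Domains of characteristic zero *)

Section Domain.
Variables (k : fieldType) (char0 : [pchar k] =i pred0) (A : comAlgType k).
Hypothesis domA : forall a b : A, a * b = 0 -> a = 0 \/ b = 0.

Lemma domain_expf_eq0 (a : A) m : a ^+ m = 0 -> a = 0.
Proof.
elim: m => [/eqP|m IH]; first by rewrite expr0 oner_eq0.
by rewrite exprS => /domA[].
Qed.

Lemma natr_alg_eq0 (a : A) m : (0 < m)%N -> m%:R * a = 0 -> a = 0.
Proof.
move=> m0; rewrite mulr_natl -scaler_nat => /eqP.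
by rewrite scaler_eq0 (pcharf0P _).1 // (gtn_eqF m0) => /eqP.
Qed.

(** The hypothesis gives [\sum_i P(y_i) = 0] for every polynomial [P] divisible
    by ['X^N].  Taking for [P] the product of ['X^N] and of the ['X - y_i] with
    [y_i] distinct from [y_i0] leaves only the multiple [P(y_i0)] of the number
    of indices where the value [y_i0] is taken. *)
Lemma power_sums_eq0 r (y : 'I_r -> A) N :
  (forall m, (N <= m)%N -> \sum_(i < r) y i ^+ m = 0) -> forall i, y i = 0.
Proof.
move=> sum0 i0; have [//|/eqP y0] := eqVneq (y i0) 0.
have psum0 (P : {poly A}) : \sum_(i < r) (P * 'X^N).[y i] = 0.
  under eq_bigr => i _ do rewrite hornerM hornerXn horner_coef mulr_suml.
  rewrite exchange_big big1 //= => j _.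
  under eq_bigr => i _ do rewrite -mulrA -exprD.
  by rewrite -mulr_sumr sum0 ?mulr0 ?leq_addl.
pose Q := \prod_(i < r | y i != y i0) ('X - (y i)%:P).
have := psum0 Q; rewrite (bigID (fun i => y i == y i0)) /= [X in _ + X]big1.
  rewrite addr0 (eq_bigr (fun=> (Q * 'X^N).[y i0])) => [|i /eqP-> //].
  rewrite sumr_const -mulr_natl => /natr_alg_eq0 Q0.
  have /Q0 : (0 < #|[pred i | y i == y i0]|)%N by apply/card_gt0P; exists i0; apply/eqxx.
  rewrite hornerM hornerXn => /domA[|/domain_expf_eq0/y0//].
  rewrite horner_prod => /eqP; apply: contraTeq => _.
  elim/big_ind: _ => [|u v u0 v0|i yi0]; first exact: oner_neq0.
    by apply/eqP => /domA[] /eqP; [apply/negP|apply/negP].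
  by rewrite hornerXsubC subr_eq0 eq_sym.
move=> i yi; rewrite hornerM horner_prod (bigD1 i) //= hornerXsubC subrr.
by rewrite !mul0r.
Qed.

(** Dedekind's independence of characters, for ring endomorphisms seen only as
    monoid morphisms.  Subtracting [chi_n(b)] times the relation at [a] from the
    relation at [b a] removes the last character and multiplies the [j]-th
    coefficient by [chi_j(b) - chi_n(b)]. *)
Lemma characters_independent n (chi : nat -> A -> A) (alpha : nat -> A) :
  (forall j, chi j 1 = 1) -> (forall j, {morph chi j : a b / a * b}) ->
  (forall i j, (i < j < n)%N -> exists b, chi i b <> chi j b) ->
  (forall a, \sum_(j < n) alpha j * chi j a = 0) ->
  forall j, (j < n)%N -> alpha j = 0.
Proof.
move=> chi1 chiM; elim: n alpha => // n IH alpha dist rel.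
have alpha0 j : (j < n)%N -> alpha j = 0.
  move=> ltjn; have [b chib] : exists b, chi j b <> chi n b.
    by apply: dist; rewrite ltjn ltnS leqnn.
  suff /domA[//|/eqP] : alpha j * (chi j b - chi n b) = 0 by rewrite subr_eq0 => /eqP.
  apply: (IH (fun j => alpha j * (chi j b - chi n b))) => // [i i' /andP[ii' i'n]|a].
    by apply: dist; rewrite ii' ltnS ltnW.
  have E : \sum_(j < n.+1) alpha j * chi j (b * a) -
           chi n b * \sum_(j < n.+1) alpha j * chi j a = 0.
    by rewrite !rel mulr0 subrr.
  apply: etrans E; rewrite mulr_sumr -sumrB big_ord_recr /= chiM.
  rewrite [X in _ = _ + X](_ : _ = 0) ?addr0; last by ring.
  by apply: eq_bigr => i _; rewrite chiM; ring.
move=> j; rewrite ltnS leq_eqVlt => /predU1P[->|]; last exact: alpha0.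
have := rel 1; rewrite big_ord_recr /= big1 => [|i _]; first by rewrite add0r chi1 mulr1.
by rewrite alpha0 ?mul0r.
Qed.

(** * Symbols of differential operators *)

Variable D : A -> A.
Hypothesis derD : derivation D.

(** [L] behaves like a differential operator of order at most [e] whose
    coefficient of [D^e] is [alpha].  Only commutators with multiplications
    enter, as in Grothendieck's definition: the commutator of [alpha D^e] with
    [c] is [e alpha D(c) D^(e-1)] up to lower order. *)
Fixpoint has_symbol e alpha (L : A -> A) : Prop :=
  if e is e'.+1 then
    forall c, has_symbol e' (e%:R * alpha * D c) (fun u => L (c * u) - c * L u)
  else forall u, L u = alpha * u.

Lemma has_symbol_ext e alpha L L' :
  L =1 L' -> has_symbol e alpha L -> has_symbol e alpha L'.
Proof. by move=> /funext->. Qed.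

Lemma has_symbolD e alpha beta L L' : has_symbol e alpha L ->
  has_symbol e beta L' -> has_symbol e (alpha + beta) (fun u => L u + L' u).
Proof.
elim: e alpha beta L L' => [|e IH] alpha beta L L' /= symL symL' => [u|c].
  by rewrite symL symL' mulrDl.
rewrite mulrDr mulrDl; move: (IH _ _ _ _ (symL c) (symL' c)).
by apply: has_symbol_ext => u /=; ring.
Qed.

Lemma has_symbolMl e alpha a L : has_symbol e alpha L ->
  has_symbol e (a * alpha) (fun u => a * L u).
Proof.
elim: e alpha L => [|e IH] alpha L /= symL => [u|c]; first by rewrite symL mulrA.
have -> : e.+1%:R * (a * alpha) * D c = a * (e.+1%:R * alpha * D c) by ring.
by apply: has_symbol_ext (IH _ _ (symL c)) => u /=; ring.
Qed.

Lemma has_symbolS e alpha L : has_symbol e alpha L -> has_symbol e.+1 0 L.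
Proof.
elim: e alpha L => [|e IH] alpha L symL c.
  by move=> u; rewrite /= in symL *; rewrite !symL; ring.
by rewrite mulr0 mul0r; apply: IH (symL c).
Qed.

(** [L D] has the symbol of [L], one order higher: in
    [[L D, c] = [L, c] D + [L, D c] + D c L] the middle term has lower order. *)
Lemma has_symbol_comp e alpha L : {morph L : u v / u + v} ->
  has_symbol e alpha L -> has_symbol e.+1 alpha (fun u => L (D u)).
Proof.
elim: e alpha L => [|e IH] alpha L LD symL c.
  move=> u; rewrite /= in symL; rewrite !symL derD.2; ring.
have LcD : {morph (fun u => L (c * u) - c * L u) : u v / u + v}.
  by move=> u v; rewrite mulrDr !LD; ring.
have := has_symbolD (IH _ _ LcD (symL c))
  (has_symbolD (has_symbolS (symL (D c))) (has_symbolMl (D c) symL)).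
rewrite add0r; have -> : e.+1%:R * alpha * D c + D c * alpha = e.+2%:R * alpha * D c.
  by rewrite -[e.+2]addn1 natrD; ring.
by apply: has_symbol_ext => u; rewrite derD.2 LD; ring.
Qed.

(** Commuting [e] times with [c] reduces [L] to a multiplication operator, and
    never leaves the operators that vanish on the ideal [I]. *)
Lemma has_symbol_vanishing (I : A -> Prop) e alpha L :
  (forall c u, I u -> I (c * u)) -> has_symbol e alpha L ->
  (forall u, I u -> L u = 0) ->
  forall c u, I u -> (e`!)%:R * (alpha * D c ^+ e * u) = 0.
Proof.
move=> idI; elim: e alpha L => [|e IH] alpha L symL L0 c u Iu.
  by rewrite fact0 mul1r expr0 mulr1 -symL L0.
have := IH _ _ (symL c) _ c u Iu; rewrite factS natrM exprS => <- => [|v Iv].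
  ring.
by rewrite !L0 ?mulr0 ?subr0 //; apply: idI.
Qed.

Lemma scalar_has_symbol e c : has_symbol e.+1 0 (fun u => c *: u).
Proof.
elim: e => [|e]; last exact: has_symbolS.
by apply: (@has_symbolS _ c%:A) => u; rewrite -scalerAl mul1r.
Qed.

(** [p] is only bounded in degree, so that the symbol may be zero: this is what
    lets the lower coefficients be treated on a par with the leading one. *)
Lemma opoly_has_symbol e (p : {poly k}) : (size p <= e.+1)%N ->
  has_symbol e (p`_e)%:A (fun u => opoly D u p).
Proof.
elim: e p => [|e IH] p lepe.
  by move=> u; rewrite (opolyE _ _ lepe) big_ord1 -scalerAl mul1r.
elim/poly_ind: p lepe => [_|p c _].
  rewrite coef0 scale0r; apply: has_symbol_ext (scalar_has_symbol e 0) => u.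
  by rewrite linear0 scale0r.
rewrite size_MXaddC coefD coefMX coefC addr0 /=; case: ifP => [/andP[/eqP-> /eqP->] _|_ lepe].
  rewrite mul0r polyC0 addr0 coef0 scale0r.
  apply: has_symbol_ext (scalar_has_symbol e 0) => u.
  by rewrite linear0 scale0r.
rewrite -[_%:A]addr0.
have LD : {morph (opoly D)^~ p : u v / u + v}.
  by move=> u v; rewrite -[u]scale1r opoly_linearl ?scale1r //; exact: derD.1.
have := has_symbolD (has_symbol_comp LD (IH p lepe)) (scalar_has_symbol e c).
by apply: has_symbol_ext => u; rewrite linearD /= opolyMX opolyC.
Qed.

(** A derivation does not preserve the powers of the maximal ideal, so [I] may fail
    to be stable under [D]: the commutators of [p(D)] are taken on the whole ring
    and restricted to [I] only at the end, where they give [e! a D(c)^e u = 0] with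
    [e] the degree and [a] the leading coefficient of [p]. *)
Lemma algebraic_derivation_eq0 (I : A -> Prop) (p : {poly k}) :
  (forall c u, I u -> I (c * u)) -> p != 0 ->
  (forall u, I u -> opoly D u p = 0) ->
  forall c u, I u -> u <> 0 -> D c = 0.
Proof.
move=> idI p0 pI c u Iu u0.
have sz : (size p <= (size p).-1.+1)%N by rewrite leqSpred.
have := has_symbol_vanishing idI (opoly_has_symbol sz) pI c Iu.
move/natr_alg_eq0; rewrite fact_gt0 => /(_ isT)/domA[|//].
rewrite -lead_coefE mulr_algl => /eqP; rewrite scaler_eq0 lead_coef_eq0 (negPf p0).
by move=> /eqP/domain_expf_eq0.
Qed.

End Domain.

(** * Two kinds of Mathieu-Zhao images in a domain *)

Lemma telescope_sum (V : zmodType) (F : nat -> V) s :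
  \sum_(i < s) (F i - F i.+1) = F 0%N - F s.
Proof.
elim: s => [|s IH]; first by rewrite big_ord0 subrr.
by rewrite big_ord_recr /= IH addrA subrK.
Qed.

Section Images.
Variables (k : fieldType) (char0 : [pchar k] =i pred0) (A : comAlgType k).
Hypothesis domA : forall a b : A, a * b = 0 -> a = 0 \/ b = 0.

Lemma domain_range0_MZ (T : A -> A) : (forall a, T a = 0) -> MZ_space (range T).
Proof.
move=> T0; split=> [|a [N aN] b].
  split; first by exists 0.
  by move=> c _ _ [u _ <-] [v _ <-]; exists 0; rewrite // !T0 scaler0 addr0.
have /(domain_expf_eq0 domA)-> : a ^+ N = 0 by have [c _ <-] := aN N (leqnn N).
by exists 1%N; split=> // -[//|m] _; exists 0; rewrite // T0 expr0n mulr0.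
Qed.

Lemma iter_lrmorphism (phi : {lrmorphism A -> A}) i :
  exists psi : {lrmorphism A -> A}, psi =1 iter i phi.
Proof.
elim: i => [|i [psi psiE]]; first by exists [the {lrmorphism A -> A} of idfun].
by exists [the {lrmorphism A -> A} of phi \o psi] => a /=; rewrite psiE.
Qed.

(** Both halves are telescoping sums: [phi^s + ... + phi^(s + r - 1)] kills the
    image of [1 - phi], and conversely every [c] with [phi^s c = 0] is the image
    under [1 - phi] of [c + phi c + ... + phi^(s - 1) c]. *)
Lemma eventually_periodic_MZ (phi : {lrmorphism A -> A}) (delta : A -> A) s r :
  (forall a, delta a = a - phi a) -> (0 < r)%N ->
  iter s phi =1 iter (s + r) phi -> MZ_space (range delta).
Proof.
move=> deltaE r0 per; split=> [|a [N aN] b].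
  split; first by exists 0; rewrite // deltaE rmorph0 subr0.
  move=> c _ _ [u _ <-] [v _ <-]; exists (c *: u + v); rewrite // !deltaE.
  by rewrite linearP /= scalerBr opprD addrACA.
have [psi psiE] := iter_lrmorphism phi s.
have sum0 m : (N <= m)%N -> \sum_(i < r) iter i phi (psi a) ^+ m = 0.
  move=> /aN[c _ cE].
  have E i : iter i phi (psi a) ^+ m = iter i phi (psi c) - iter i.+1 phi (psi c).
    have [xi xiE] := iter_lrmorphism phi i.
    rewrite iterSr -!xiE -!rmorphXn -rmorphB /= -cE deltaE rmorphB /=.
    by rewrite !psiE -iterSr.
  under eq_bigr do rewrite E.
  rewrite (telescope_sum (fun i => iter i phi (psi c))) /=.
  by rewrite !psiE -iterD addnC -per subrr.
have psia : psi a = 0.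
  by have := power_sums_eq0 char0 domA sum0 (Ordinal r0).
exists 1%N; split=> // -[//|m] _.
have : psi (b * a ^+ m.+1) = 0 by rewrite rmorphM rmorphXn /= psia expr0n mulr0.
move: (b * _) => c; rewrite psiE => phic.
exists (\sum_(i < s) iter i phi c) => //.
rewrite deltaE linear_sum /= -sumrB.
by rewrite (telescope_sum (fun i => iter i phi c)) phic subr0.
Qed.

End Images.

(** * The order filtration of power series *)

Section Series.
Variables (n : nat) (k : fieldType).
Local Notation A := (mfps n k).
Implicit Types (f g : A) (m : 'X_{1..n}) (N : nat).

Definition order_ge N f := forall m, (mdeg m < N)%N -> fcoeff f m = 0.

Lemma order_ge0 N : order_ge N 0.
Proof. by []. Qed.

Lemma order_geD N f g : order_ge N f -> order_ge N g -> order_ge N (f + g).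
Proof. by move=> f0 g0 m ltm /=; rewrite f0 // g0 // addr0. Qed.

Lemma order_geN N f : order_ge N f -> order_ge N (- f).
Proof. by move=> f0 m ltm /=; rewrite f0 // oppr0. Qed.

Lemma order_geB N f g : order_ge N f -> order_ge N g -> order_ge N (f - g).
Proof. by move=> f0 g0; apply: order_geD => //; apply: order_geN. Qed.

Lemma order_geZ N c f : order_ge N f -> order_ge N (c *: f).
Proof. by move=> f0 m ltm /=; rewrite f0 // mulr0. Qed.

Lemma order_ge_sum N (I : Type) (r : seq I) (F : I -> A) :
  (forall i, order_ge N (F i)) -> order_ge N (\sum_(i <- r) F i).
Proof. by move=> F0; elim/big_ind: _ => //; exact: order_geD. Qed.

Lemma order_geW N M f : (N <= M)%N -> order_ge M f -> order_ge N f.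
Proof. by move=> leNM f0 m ltm; apply: f0; apply: leq_trans leNM. Qed.

Lemma order_geM N M f g : order_ge N f -> order_ge M g -> order_ge (N + M) (f * g).
Proof.
move=> f0 g0 m ltm /=; rewrite big1 // => -[k1 k2] /= /eqP mE.
have [ltk1|lek1] := ltnP (mdeg k1) N; first by rewrite f0 // mul0r.
rewrite g0 ?mulr0 // ltnNge; apply: contraL ltm => leM.
by rewrite -leqNgt (congr1 mdeg mE) mdegD leq_add.
Qed.

Lemma order_geMl N f g : order_ge N g -> order_ge N (f * g).
Proof. by move=> /(@order_geM 0 N f g); apply. Qed.

Lemma order_geX f i : order_ge 1 f -> order_ge i (f ^+ i).
Proof.
move=> f1; elim: i => [|i IH]; first by move=> m; rewrite ltn0.
by rewrite exprS -add1n; apply: order_geM.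
Qed.

Lemma order_ge_eq0 f : (forall N, order_ge N f) -> f = 0.
Proof. by move=> f0; apply: mfpsP => m; apply: (f0 (mdeg m).+1). Qed.

(** Completeness.  The limit takes its coefficients of degree [d] from the term of
    index [d + 1], which is final in these degrees since [d + 1 <= K (d + 1)]. *)
Lemma order_ge_limit (s : nat -> A) (K : nat -> nat) :
  (forall d, (d <= K d)%N) -> (forall d, (K d <= K d.+1)%N) ->
  (forall d, order_ge (K d) (s d.+1 - s d)) ->
  exists f, forall d, order_ge (K d) (f - s d).
Proof.
move=> leK monoK close.
have Kle d e : (d <= e)%N -> (K d <= K e)%N.
  by move=> /subnK <-; elim: (e - d)%N => // j IH; apply: leq_trans (monoK _).
have far d e : (d <= e)%N -> order_ge (K d) (s e - s d).
  move=> /subnK <-; elim: (e - d)%N => [|j IH]; first by rewrite subrr.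
  rewrite addSn -[_ - _](subrKA (s (j + d)%N)); apply: order_geD => //.
  by apply: order_geW (close _); apply: Kle; rewrite leq_addl.
exists (MFps (fun m => fcoeff (s (mdeg m).+1) m)) => d m ltm.
change (fcoeff (s (mdeg m).+1) m - fcoeff (s d) m = 0).
have [led|/ltnW led] := leqP d (mdeg m).+1; first exact: (far _ _ led m ltm).
have /eqP := far _ _ led m (leK _); rewrite /= addrC => /eqP E.
by rewrite -[LHS]opprK opprB /= addrC E oppr0.
Qed.

Lemma geometric_inverse f : order_ge 1 f -> exists g, (1 - f) * g = 1.
Proof.
move=> f1; pose s d := \sum_(i < d) f ^+ i.
have [||d|g gP] := @order_ge_limit s id => //.
  by rewrite /s big_ord_recr /= addrAC subrr add0r; apply: order_geX.
exists g; apply/eqP; rewrite -subr_eq0; apply/eqP/order_ge_eq0 => N.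
have -> : (1 - f) * g - 1 = (1 - f) * (g - s N) - f ^+ N.
  have sN : (1 - f) * s N = 1 - f ^+ N.
    by rewrite -[RHS]opprB subrX1 -mulNr opprB.
  by rewrite mulrBr sN; ring.
by apply: order_geB; [apply: order_geMl|apply: order_geX].
Qed.

Lemma order_ge1_const f : order_ge 1 (f - fcoeff f 0%MM *: 1).
Proof.
move=> m; rewrite ltnS leqn0 mdeg_eq0 => /eqP->.
by rewrite /= eqxx mulr1 subrr.
Qed.

Lemma order_ge1P f : fcoeff f 0%MM = 0 -> order_ge 1 f.
Proof. by move=> f0 m; rewrite ltnS leqn0 mdeg_eq0 => /eqP->. Qed.

Lemma minimal_monomial f : f <> 0 ->
  exists2 m, fcoeff f m <> 0 & forall m', (m' < m)%O -> fcoeff f m' = 0.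
Proof.
move=> f0; apply: contrapT => nomin; apply: f0; apply: mfpsP.
elim/(@ltmwf n) => m IH; apply: contrapT => fm; apply: nomin; exists m => //.
Qed.

(** The coefficient of [f g] at the sum of the minimal monomials of [f] and [g]
    is the product of the two minimal coefficients, because the order on monomials
    is compatible with addition. *)
Lemma mfps_domain f g : f * g = 0 -> f = 0 \/ g = 0.
Proof.
move=> fg; have [|/minimal_monomial[a fa mina]] := pselect (f = 0); first by left.
have [|/minimal_monomial[b gb minb]] := pselect (g = 0); first by right.
exfalso; suff fgab : fcoeff (f * g) (a + b)%MM = fcoeff f a * fcoeff g b.
  move/eqP: fgab; rewrite fg /= eq_sym mulf_eq0.
  by move=> /orP[/eqP|/eqP].
have lta : (mdeg a < (mdeg (a + b)%MM).+1)%N by rewrite ltnS mdegD leq_addr.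
have ltb : (mdeg b < (mdeg (a + b)%MM).+1)%N by rewrite ltnS mdegD leq_addl.
rewrite /= (bigD1 (BMultinom lta, BMultinom ltb)) //= big1 ?addr0 //.
move=> [c d] /= /andP[/eqP cd ncd].
have [/mina->|leac] := ltP (val c) a; first by rewrite mul0r.
have [/minb->|lebd] := ltP (val d) b; first by rewrite mulr0.
have [eqca|neqca] := eqVneq a c.
  move: cd; rewrite -eqca => /addmI bd; exfalso; move: ncd.
  by rewrite -pair_eqE /= !bmeqP /= -eqca -bd !eqxx.
have ltac : (a < c)%O by rewrite lt_neqAle neqca.
by have /lt_eqF/negbT/eqP := ltmc_le_add ltac lebd.
Qed.

End Series.

(** * From local to uniform algebraicity *)

Section Baire.
Variables (n : nat) (k : fieldType).
Local Notation A := (mfps n k).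
Implicit Types (p q : {poly k}) (f g : A).
Variable T : A -> A.
Hypotheses (linT : linear T)
  (contT : forall N f, order_ge N.+1 f -> order_ge N (T f)).

(** [f, T f, ..., T^(d-1) f] are linearly independent modulo the series of order
    at least [N]. *)
Definition indep_mod d N f := forall p : {poly k},
  (size p <= d)%N -> order_ge N (opoly T f p) -> p = 0.

Lemma indep_modW d N M f : (N <= M)%N -> indep_mod d N f -> indep_mod d M f.
Proof. by move=> leNM ind p lepd /(order_geW leNM); apply: ind. Qed.

Lemma order_ge_opoly d N f p : (size p <= d.+1)%N ->
  order_ge (N + d) f -> order_ge N (opoly T f p).
Proof.
move=> lepd fN; rewrite (opolyE _ _ lepd); apply: order_ge_sum => i.
have iterN j : (j <= d)%N -> order_ge (N + (d - j)) (iter j T f).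
  elim: j => [|j IH] ltjd; first by rewrite subn0.
  by apply: contT; rewrite -addnS -subSn // subSS; apply/IH/ltnW.
apply: order_geZ; apply: order_geW (iterN i (ltn_ord i)).
exact: leq_addr.
Qed.

(** Two relations of degree at most [d] are proportional, since eliminating
    their top coefficients yields a relation of lower degree, hence trivial. *)
Lemma indep_mod_proportional d N f p q : indep_mod d N f ->
  (size p <= d.+1)%N -> (size q <= d.+1)%N ->
  order_ge N (opoly T f p) -> order_ge N (opoly T f q) ->
  p != 0 -> exists c, q = c *: p.
Proof.
move=> ind szp szq pN qN p0.
have pd : p`_d != 0.
  apply: contraNneq p0 => pd0; apply/eqP/ind => //.
  apply/leq_sizeP => j; rewrite leq_eqVlt => /predU1P[<-//|].
  by move/leq_sizeP: szp; apply.
exists (q`_d / p`_d); apply/eqP; rewrite -subr_eq0; apply/eqP/ind.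
  apply/leq_sizeP => j; rewrite leq_eqVlt coefB coefZ => /predU1P[<-|ltdj].
    by rewrite divfK ?subrr.
  by rewrite [q`_j]nth_default ?[p`_j]nth_default ?(leq_trans _ ltdj) // mulr0 subrr.
by rewrite linearB linearZ; apply: order_geB => //; apply: order_geZ.
Qed.

(** Linear independence is already seen modulo some order.  Otherwise there would
    be relations modulo every order; being proportional to one another, they are
    a single relation, which holds modulo every order and so holds exactly. *)
Lemma indep_mod_exists d f :
  (forall p, (size p <= d)%N -> opoly T f p = 0 -> p = 0) ->
  exists N, indep_mod d N f.
Proof.
elim: d => [|d IH] ind.
  by exists 0%N => p szp _; apply/eqP; rewrite -size_poly_eq0 -leqn0.
have [N indN] : exists N, indep_mod d N f.
  by apply: IH => p szp; apply: ind; apply: leqW.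
apply: contrapT => /forallNP dep.
have {}dep M : exists p, [/\ (size p <= d.+1)%N, order_ge M (opoly T f p) & p != 0].
  apply: contrapT => /forallNP nop; apply: (dep M) => p szp pM.
  by apply/eqP; apply: contrapT => /negP p0; apply: (nop p).
have [p [szp pN p0]] := dep N.
suff fp : opoly T f p = 0 by rewrite (ind p) ?eqxx in p0.
apply: order_ge_eq0 => M; have [q [szq qM q0]] := dep (maxn N M).
have qN : order_ge N (opoly T f q) by apply: order_geW qM; apply: leq_maxl.
have [c pE] := indep_mod_proportional indN szq szp qN pN q0.
rewrite pE linearZ; apply: order_geZ; apply: order_geW qM; exact: leq_maxr.
Qed.

(** The inductive step of the category argument.  Suppose that no correction [w] of
    order at least [N + d] helps, so that each [f + w] has a relation [q] of degree
    at most [d].  As [T] is applied at most [d] times, [q] is also a relation of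
    [f] modulo order [N], hence proportional to the relation [p] of [f]
    itself.  So [p(T)] kills [f + w] and [f], hence kills all such [w]. *)
Lemma indep_mod_extend d N f :
  (forall p M, p != 0 -> exists2 w, order_ge M w & opoly T w p <> 0) ->
  indep_mod d N f ->
  exists g M, [/\ (N <= M)%N, order_ge (N + d) (g - f) & indep_mod d.+1 M g].
Proof.
move=> nonalg ind; apply: contrapT => nog.
have dep w : order_ge (N + d) w ->
    exists p, [/\ (size p <= d.+1)%N, opoly T (f + w) p = 0 & p != 0].
  move=> wN; apply: contrapT => /forallNP nop; apply: nog.
  have [p szp fwp|M indM] := @indep_mod_exists d.+1 (f + w).
    by apply/eqP; apply: contrapT => /negP p0; apply: (nop p).
  exists (f + w), (maxn N M); rewrite leq_maxl addrC addKr; split=> //.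
  exact: indep_modW (leq_maxr _ _) indM.
have [p [szp fp p0]] := dep 0 (@order_ge0 _ _ _).
rewrite addr0 in fp.
have [w wN wp] := nonalg p (N + d)%N p0; apply: wp.
have [q [szq fwq q0]] := dep w wN.
have lin r g h : opoly T (g + h) r = opoly T g r + opoly T h r.
  by rewrite -[g]scale1r opoly_linearl // !scale1r.
rewrite lin in fwq.
have fqN : order_ge N (opoly T f q).
  rewrite (_ : opoly T f q = - opoly T w q); last by apply/eqP; rewrite -addr_eq0 fwq.
  by apply: order_geN; apply: order_ge_opoly wN.
have fpN : order_ge N (opoly T f p) by rewrite fp.
have [c pE] := indep_mod_proportional ind szq szp fqN fpN q0.
have : opoly T w p = c *: (opoly T f q + opoly T w q) - opoly T f p.
  by rewrite pE !linearZ /= -scalerDr addrAC subrr add0r.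
by rewrite fwq fp scaler0 subr0.
Qed.

(** The series [f] is the limit of the [s d], where [s d] has its first [d]
    iterates independent modulo order [N_d] and the next corrections have order at
    least [N_d + d], too large to affect this even after [d] applications of
    [T]. *)
Lemma locally_algebraic_uniform :
  (forall f, exists2 p : {poly k}, p != 0 & opoly T f p = 0) ->
  exists2 p : {poly k}, p != 0 & exists M, forall w, order_ge M w -> opoly T w p = 0.
Proof.
move=> locT; apply: contrapT => nounif.
have nonalg p M : p != 0 -> exists2 w, order_ge M w & opoly T w p <> 0.
  move=> p0; apply: contrapT => now; apply: nounif; exists p => //; exists M => w wM.
  by apply: contrapT => wp; apply: now; exists w.
have next_ex (x : nat * (A * nat)) : exists y : A * nat, indep_mod x.1 x.2.2 x.2.1 ->
    [/\ (x.2.2 <= y.2)%N, order_ge (x.2.2 + x.1) (y.1 - x.2.1)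
      & indep_mod x.1.+1 y.2 y.1].
  have [ind|nind] := pselect (indep_mod x.1 x.2.2 x.2.1); last by exists (0, 0%N).
  by have [g [M gM]] := indep_mod_extend nonalg ind; exists (g, M).
have [next nextP] := choice next_ex.
pose s := fix s d := if d is d'.+1 then next (d', s d') else ((0, 0%N) : A * nat).
have sind d : indep_mod d (s d).2 (s d).1.
  elim: d => [|d IH]; last by have [] := nextP (d, s d) IH.
  by move=> p szp _; apply/eqP; rewrite -size_poly_eq0 -leqn0.
have sP d := nextP (d, s d) (sind d).
have [|d|d|f fs] := @order_ge_limit _ _ (fun d => (s d).1) (fun d => (s d).2 + d)%N.
- by move=> d; apply: leq_addl.
- by have [leN _ _] := sP d; apply: leq_add.
- by have [_ cl _] := sP d.
have [p p0 fp] := locT f; have/eqP := p0; apply.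
apply: (sind (size p)) => //.
have -> : opoly T (s (size p)).1 p = - opoly T (f - (s (size p)).1) p.
  by rewrite opolyBl // fp sub0r opprK.
by apply: order_geN; apply: order_ge_opoly (fs _); apply: leqnSn.
Qed.

End Baire.

(** * Derivations and endomorphisms of power series *)

Section Endos.
Variables (n : nat) (k : fieldType) (char0 : [pchar k] =i pred0).
Local Notation A := (mfps n k).
Let domA := @mfps_domain n k.

Definition mvar (i : 'I_n) : A := MFps (fun m => (m == U_(i)%MM)%:R).

Lemma coef_mvarM i (g : A) m :
  fcoeff (mvar i * g) m = if (0 < m i)%N then fcoeff g (m - U_(i))%MM else 0.
Proof.
case: ifPn => [mi|]; last first.
  rewrite -eqn0Ngt => /eqP mi /=; rewrite big1 // => -[a b] /= /eqP mE.
  case: eqP => [aU|]; last by rewrite mul0r.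
  by have := congr1 (fun m1 : 'X_{1..n} => m1 i) mE; rewrite mi aU mnmDE mnm1E eqxx.
have mU : (U_(i) + (m - U_(i)) = m)%MM.
  by rewrite addmC submK //; apply/mnm_lepP => j; rewrite mnm1E; case: eqP => // <-.
have lta : (mdeg U_(i)%MM < (mdeg m).+1)%N by rewrite -mU mdegD ltnS leq_addr.
have ltb : (mdeg (m - U_(i))%MM < (mdeg m).+1)%N by rewrite ltnS mdegB.
rewrite /= (bigD1 (BMultinom lta, BMultinom ltb)) /= ?mU //.
rewrite eqxx mul1r big1 ?addr0 // => -[a b] /= /andP[/eqP mE nab].
case: eqP => [aU|]; last by rewrite mul0r.
case/negP: nab; rewrite -pair_eqE /= !bmeqP /= aU eqxx /=; apply/eqP.
by apply: (@addmI _ U_(i)%MM); rewrite mU -aU -mE.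
Qed.

(** By Euler's identity: the monomial [m] of [f], of degree [|m|], is shared
    between the variables in the proportions [m_i / |m|].  This choice is symmetric
    in the variables and uses characteristic zero. *)
Lemma order_ge_mvar N (f : A) : order_ge N.+1 f ->
  exists2 g : 'I_n -> A, (forall i, order_ge N (g i)) & f = \sum_i mvar i * g i.
Proof.
move=> fN.
pose g i : A := MFps (fun m => (m i).+1%:R / (mdeg m).+1%:R * fcoeff f (m + U_(i))%MM).
exists g => [i m ltm|]; first by rewrite /= fN ?mulr0 // mdegD mdeg1 addn1.
apply: mfpsP => m.
have -> : fcoeff (\sum_i mvar i * g i) m = \sum_i fcoeff (mvar i * g i) m.
  by elim/big_rec2: _ => // i x y _ /= ->.
have [->|m0] := eqVneq m 0%MM.
  by rewrite big1 => [|i _]; [rewrite fN ?mdeg0 | rewrite coef_mvarM mnm0E].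
transitivity (\sum_i (m i)%:R / (mdeg m)%:R * fcoeff f m).
  rewrite -!mulr_suml -natr_sum -mdegE divff ?mul1r //.
  by rewrite (pcharf0P _).1 // mdeg_eq0.
apply: eq_bigr => i _; rewrite coef_mvarM; case: ifP => [mi|]; last first.
  by move/negbT; rewrite -eqn0Ngt => /eqP->; rewrite !mul0r.
have le : (U_(i) <= m)%MM by apply/mnm_lepP => j; rewrite mnm1E; case: eqP => // <-.
rewrite /= submK // mnmBE mnm1E eqxx subn1 prednK //.
by rewrite -{2}(submK le) mdegD mdeg1 addn1.
Qed.

Lemma linear_sum_fun (T : A -> A) (r : seq 'I_n) (F : 'I_n -> A) : linear T ->
  T (\sum_(i <- r) F i) = \sum_(i <- r) T (F i).
Proof.
move=> linT; elim/big_rec2: _ => [|i x y _ <-]; first exact: linear_at0.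
by rewrite -[F i]scale1r linT !scale1r.
Qed.

Lemma derivation_continuous (D : A -> A) : derivation D ->
  forall N f, order_ge N.+1 f -> order_ge N (D f).
Proof.
move=> [linD Leib]; elim=> [|N IH] f fN; first by move=> m; rewrite ltn0.
have [g gN ->] := order_ge_mvar fN.
rewrite linear_sum_fun //; apply: order_ge_sum => i; rewrite Leib.
apply: order_geD; first exact: order_geMl.
rewrite -add1n; apply: order_geM; last exact: IH.
apply: order_ge1P => /=; rewrite (_ : (_ == _) = false) //.
by apply/eqP => /(congr1 mdeg); rewrite mdeg0 mdeg1.
Qed.

(** If [phi f] had a constant term [c <> 0], then [1 - f / c] would be invertible
    while its image under [phi] has constant term zero. *)
Lemma lrmorphism_order_ge1 (phi : {lrmorphism A -> A}) f :
  order_ge 1 f -> order_ge 1 (phi f).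
Proof.
move=> f1; apply: order_ge1P; apply/eqP; apply: contrapT => /negP c0.
set c := fcoeff _ _ in c0.
have [|u uP] := @geometric_inverse n k (c^-1 *: f); first exact: order_geZ.
have phi1 : order_ge 1 (phi (1 - c^-1 *: f)).
  apply: order_ge1P; rewrite linearB linearZ rmorph1 /= eqxx -/c mulVf //.
  by rewrite subrr.
have := order_geMl (phi u) phi1; rewrite mulrC -rmorphM uP rmorph1.
by move=> /(_ 0%MM); rewrite mdeg0 /= eqxx => /(_ isT)/eqP; rewrite oner_eq0.
Qed.

Lemma lrmorphism_continuous (phi : {lrmorphism A -> A}) N f :
  order_ge N f -> order_ge N (phi f).
Proof.
elim: N f => [|N IH] f fN; first by move=> m; rewrite ltn0.
have [g gN ->] := order_ge_mvar fN.
rewrite linear_sum; apply: order_ge_sum => i; rewrite rmorphM -add1n.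
apply: order_geM; last exact: IH.
apply: lrmorphism_order_ge1; apply: order_ge1P => /=.
rewrite (_ : (_ == _) = false) //.
by apply/eqP => /(congr1 mdeg); rewrite mdeg0 mdeg1.
Qed.

(** It suffices to treat [f] of order at least [1].  Then [f ^+ M] has order at
    least [M], and is nonzero unless [f] is zero; choosing this element rather
    than a monomial covers the case [n = 0]. *)
Lemma locally_finite_derivation_eq0 (D : A -> A) :
  derivation D -> locally_finite D -> forall f, D f = 0.
Proof.
move=> derD lfD; have [linD Leib] := derD.
have [p p0 [M pM]] := locally_algebraic_uniform linD (derivation_continuous derD)
  (fun f => locally_finite_annihilated f lfD).
have D0 f : order_ge 1 f -> D f = 0.
  move=> f1; have [->|/eqP f0] := eqVneq f 0; first exact: linear_at0.
  have idI (c u : A) : order_ge M u -> order_ge M (c * u) by apply: order_geMl.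
  apply: (algebraic_derivation_eq0 char0 domA derD idI p0 pM _ (@order_geX _ _ f M f1)).
  by move/(domain_expf_eq0 domA).
have D1 : D 1 = 0.
  by have /eqP := Leib 1 1; rewrite !mulr1 mul1r -subr_eq0 opprD addNKr oppr_eq0 => /eqP.
move=> f; rewrite -[f](subrK (fcoeff f 0%MM *: 1)) addrC linD D1 scaler0 add0r.
exact/D0/order_ge1_const.
Qed.

Lemma locally_finite_endo_periodic (phi : {lrmorphism A -> A}) (delta : A -> A) :
  (forall a, delta a = a - phi a) -> locally_finite delta ->
  exists s r, (0 < r)%N /\ iter s phi =1 iter (s + r) phi.
Proof.
move=> deltaE lfd; have linphi : linear phi by move=> c u v; rewrite linearP.
have [|f|p p0 [M pM]] := @locally_algebraic_uniform n k phi linphi.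
- by move=> N f /(@order_geW _ _ N _ _ (leqnSn N)); apply: lrmorphism_continuous.
- have [p p0 pf] := locally_finite_annihilated f lfd.
  exists (p \Po (1 - 'X)); first by rewrite comp_subX_eq0.
  by rewrite -(opoly_subid _ _ deltaE).
apply: contrapT => noper.
have dist i j : (i < j)%N -> exists b, iter i phi b <> iter j phi b.
  move=> ltij; apply: contrapT => same; apply: noper; exists i, (j - i)%N.
  rewrite subn_gt0 subnKC ?(ltnW ltij) //; split=> // b.
  by apply: contrapT => ne; apply: same; exists b.
have [psi psiE] : exists psi : nat -> {lrmorphism A -> A}, forall j, psi j =1 iter j phi.
  by have [psi psiP] := choice (iter_lrmorphism phi); exists psi.
(* Dedekind's lemma applies to the coefficients [p_j phi^j(u)], because the
   elements [u a] of order at least [M] are killed by [p(phi)]. *)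
have coef0 u j : order_ge M u -> (j < size p)%N -> p`_j *: psi j u = 0.
  move=> uM; apply: (characters_independent domA (chi := psi)
    (alpha := fun j => p`_j *: psi j u)) => [i|i a b|i i' /andP[ltii' _]|a].
  - exact: rmorph1.
  - exact: rmorphM.
  - by have [b nb] := dist _ _ ltii'; exists b; rewrite !psiE.
  transitivity (opoly phi (u * a) p).
    2: by apply: pM; rewrite mulrC; apply: order_geMl.
  by apply: eq_bigr => i _; rewrite -psiE rmorphM scalerAl.
have lt : ((size p).-1 < size p)%N by rewrite prednK ?size_poly_gt0.
have psi0 f : order_ge 1 f -> psi (size p).-1 f = 0.
  move=> f1; have /eqP := coef0 _ _ (@order_geX _ _ _ M f1) lt.
  rewrite -lead_coefE scaler_eq0 lead_coef_eq0 (negPf p0) rmorphXn.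
  by move=> /eqP/(domain_expf_eq0 domA).
have psi0' f : order_ge 1 f -> psi (size p) f = 0.
  move=> f1; rewrite psiE -(prednK (leq_ltn_trans _ lt)) // iterSr -psiE psi0 //.
  exact: lrmorphism_order_ge1.
have [b] := dist _ _ lt; rewrite -!psiE; apply.
have := order_ge1_const b; rewrite -{3 4}[b](subrK (fcoeff b 0%MM *: 1)).
by move: (b - _) => g g1; rewrite !linearD !linearZ !rmorph1 /= psi0 ?psi0'.
Qed.

End Endos.

Theorem corollary2p8 (k : fieldType) (char0 : [pchar k] =i pred0) (n : nat) :
  (forall D : mfps n k -> mfps n k,
     derivation D -> locally_finite D -> MZ_space (range D)) /\
  (forall delta : mfps n k -> mfps n k,
     E_derivation delta -> locally_finite delta -> MZ_space (range delta)).
Proof.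
split=> [D derD lfD|delta [phi deltaE] lfd].
  apply: (domain_range0_MZ (@mfps_domain n k)).
  exact: locally_finite_derivation_eq0 lfD.
have [s [r [r0 per]]] := locally_finite_endo_periodic char0 deltaE lfd.
exact: (eventually_periodic_MZ char0 (@mfps_domain n k) deltaE r0 per).
Qed.
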